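(* Let $R$ be the ring, and $d_i$ ($i\in\mathbb Z$) the $R$-linear maps, defined in the context. The sequence of homomorphisms $$\boldsymbol C:\quad \cdots\to R^{\beta_2}\xrightarrow{d_2}R^3\xrightarrow{d_1}R^2\xrightarrow{d_0}R^2\xrightarrow{d_{-1}}R^2\xrightarrow{d_{-2}}R^2\to\cdots$$ (with $C_i=R^2$ for $i\le 0$, $C_1=R^3$, and $C_i=R^{\beta_i}$ for $i\ge 2$) is a minimal complete resolution such that the following hold: (1) The sequence $\{\operatorname{rank} C_i\}_{i\ge 0}$ has exponential growth. (2) $\operatorname{rank} C_i=2$ for all $i\le 0$.
   Context: Let $k$ be a field which is not algebraic over a finite field, and let $\alpha\in k$ be an element of infinite multiplicative order. Let $P=k[T,U,V,X,Y,Z]$ be the polynomial ring in six variables (each of degree one) and $R=P/I$, where $I$ is generated by the fifteen quadrics $$Z^2,\ UZ-TX-\alpha UV,\ U^2,\ YZ+VY,\ UY,\ Y^2-TX-(\alpha-1)UV,\ XZ+\alpha VX,\ UX,\ XY,\ X^2-TX-TV,$$ $$TZ+TY+\alpha VX,\ TU,\ TY-VX+TV,\ T^2+(\alpha+1)UV-VY,\ V^2.$$ Let $t,u,v,x,y,z$ denote the residue classes of the variables modulo $I$, and $\mathfrak m=(t,u,v,x,y,z)$. The ring $R$ is local with maximal ideal $\mathfrak m$. Matrices act on column vectors with respect to standard bases. For $i\le 0$, $d_i\colon R^2\to R^2$ is given by the matrix $\begin{pmatrix} v& y\\ \alpha^{1-i}x& z\end{pmatrix}$. The map $d_1\colon R^3\to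 R^2$ is given by $\begin{pmatrix} v&y&0\\ x&z&tv\end{pmatrix}$. The maps $d_i$ for $i\ge 2$ are the differentials of a minimal free resolution of $\operatorname{Coker} d_1$ having $d_1$ as first differential: $$\cdots\to R^{\beta_i}\xrightarrow{d_i}R^{\beta_{i-1}}\to\cdots\to R^{\beta_2}\xrightarrow{d_2}R^3\xrightarrow{d_1}R^2.$$ A complete resolution is a complex $\boldsymbol C$ (indexed by $\mathbb Z$) of finitely generated free $R$-modules such that $\boldsymbol C$ and $\operatorname{Hom}_R(\boldsymbol C,R)$ are both exact (it is a complete resolution of a module $M$ if it agrees in all large degrees with a free resolution of $M$). It is minimal if $d_i(C_i)\subseteq\mathfrak m C_{i-1}$ for all $i\in\mathbb Z$. A sequence $\{c_i\}_{i\ge 0}$ has exponential growth if there exist $a,b\in\mathbb R$ with $1<a\le b$ such that $a^i\le c_i\le b^i$ for all $i\gg 0$. *)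

(* Defs.v *)
From HB Require Import structures.
From mathcomp Require Import all_boot all_order all_algebra.
From mathcomp Require Import mpoly.
From mathcomp Require Import boolp reals.

Set Implicit Arguments.
Unset Strict Implicit.
Unset Printing Implicit Defensive.

Import Order.TTheory GRing.Theory Num.Theory.
Local Open Scope ring_scope.

Definition algebraic_over_finite_field (k : fieldType) : Prop :=
  exists (F : finFieldType) (iota : {rmorphism F -> k}),
    forall x : k, algebraicOver iota x.

(* [0] satisfies [0 ^+ n != 1] for all [n > 0], hence the first conjunct. *)
Definition infinite_mult_order (k : fieldType) (a : k) : Prop :=
  a != 0 /\ forall n : nat, (0 < n)%N -> a ^+ n != 1.

Definition ideal_gen (A : comNzRingType) (s : seq A) : {pred A} :=
  fun p => `[< exists c : 'I_(size s) -> A, p = \sum_i c i * s`_i >].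

(* The submodule [J M] of [M], for [J] an ideal. *)
Definition ideal_smul (A : comNzRingType) (J : {pred A}) (M : lmodType A)
    (w : M) : Prop :=
  exists (n : nat) (a : 'I_n -> A) (m : 'I_n -> M),
    (forall i, a i \in J) /\ w = \sum_i a i *: m i.

Definition exact_pair (A : comNzRingType) (M N P : lmodType A)
    (f : {linear M -> N}) (g : {linear N -> P}) : Prop :=
  forall y : N, g y = 0 <-> exists x : M, f x = y.

Definition free_of_rank (A : comNzRingType) (M : lmodType A) (n : nat) : Prop :=
  exists f : {linear 'cV[A]_n -> M}, bijective f.

(* A sequence of maps is given by the differentials [d i : C i -> C (i - 1)];
   exactness at [C (i - 1)], for all [i], avoids any transport between
   [C (i + 1 - 1)] and [C i]. *)
Definition exact_complex (A : comNzRingType) (C : int -> lmodType A)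
    (d : forall i : int, {linear C i -> C (i - 1)}) : Prop :=
  forall i : int, exact_pair (d i) (d (i - 1)).

(* Exactness of [Hom_A(C, A)]. *)
Definition dual_exact (A : comNzRingType) (C : int -> lmodType A)
    (d : forall i : int, {linear C i -> C (i - 1)}) : Prop :=
  forall (i : int) (phi : {linear C (i - 1) -> A^o}),
    (forall w : C i, phi (d i w) = 0) <->
    exists psi : {linear C (i - 1 - 1) -> A^o},
      forall w : C (i - 1), psi (d (i - 1) w) = phi w.

Definition complete_resolution (A : comNzRingType) (C : int -> lmodType A)
    (d : forall i : int, {linear C i -> C (i - 1)}) : Prop :=
  [/\ forall i : int, exists n : nat, free_of_rank (C i) n,
      exact_complex d & dual_exact d].

Definition minimal_map (A : comNzRingType) (J : {pred A}) (M N : lmodType A)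
    (f : {linear M -> N}) : Prop :=
  forall w : M, ideal_smul J (f w).

Definition minimal_complex (A : comNzRingType) (J : {pred A})
    (C : int -> lmodType A) (d : forall i : int, {linear C i -> C (i - 1)}) :
    Prop :=
  forall i : int, minimal_map J (d i).

Definition exponential_growth (RR : realType) (c : nat -> nat) : Prop :=
  exists a b : RR, [/\ 1 < a, a <= b &
    exists N : nat, forall i : nat, (N <= i)%N ->
      a ^+ i <= (c i)%:R /\ (c i)%:R <= b ^+ i].

(* Matrices act on columns: the matrix [f n] is the map
   [A^(r n.+1) -> A^(r n)].  Exactness is required in all positive degrees, so
   that this is a free resolution of its [H_0], the cokernel of [f 0]. *)
Definition minimal_free_resolution_of_coker (A : comNzRingType) (J : {pred A})
    (r : nat -> nat) (f : forall n : nat, 'M[A]_(r n, r n.+1)) : Prop :=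
  (forall n : nat, exact_pair (mulmx (f n.+1) : {linear 'cV_(_) -> 'cV_(_)})
                              (mulmx (f n) : {linear 'cV_(_) -> 'cV_(_)})) /\
  (forall n : nat, minimal_map J (mulmx (f n) : {linear 'cV_(_) -> 'cV_(_)})).

Definition varT (k : fieldType) : {mpoly k[6]} := 'X_(@Ordinal 6 0 isT).
Definition varU (k : fieldType) : {mpoly k[6]} := 'X_(@Ordinal 6 1 isT).
Definition varV (k : fieldType) : {mpoly k[6]} := 'X_(@Ordinal 6 2 isT).
Definition varX (k : fieldType) : {mpoly k[6]} := 'X_(@Ordinal 6 3 isT).
Definition varY (k : fieldType) : {mpoly k[6]} := 'X_(@Ordinal 6 4 isT).
Definition varZ (k : fieldType) : {mpoly k[6]} := 'X_(@Ordinal 6 5 isT).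

Definition quadrics (k : fieldType) (alpha : k) : seq {mpoly k[6]} :=
  let T := varT k in let U := varU k in let V := varV k in
  let X := varX k in let Y := varY k in let Z := varZ k in
  [:: Z ^+ 2;
      U * Z - T * X - alpha *: (U * V);
      U ^+ 2;
      Y * Z + V * Y;
      U * Y;
      Y ^+ 2 - T * X - (alpha - 1) *: (U * V);
      X * Z + alpha *: (V * X);
      U * X;
      X * Y;
      X ^+ 2 - T * X - T * V;
      T * Z + T * Y + alpha *: (V * X);
      T * U;
      T * Y - V * X + T * V;
      T ^+ 2 + (alpha + 1) *: (U * V) - V * Y;
      V ^+ 2].

Definition idealI (k : fieldType) (alpha : k) : {pred {mpoly k[6]}} :=
  ideal_gen (quadrics alpha).

Lemma idealI_closed (k : fieldType) (alpha : k) : idealr_closed (idealI alpha).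
Proof.
split.
- apply/asboolP; exists (fun=> 0).
  by rewrite big1 // => i _; rewrite mul0r.
- apply/asboolP => -[c] /(congr1 (meval (fun=> 0))) /eqP.
  rewrite meval1 raddf_sum big1 ?oner_eq0 // => -[i lti] _ /=.
  rewrite mevalM; suff -> : meval (fun=> 0) (quadrics alpha)`_i = 0.
    by rewrite mulr0.
  do 15 (case: i lti => [|i] lti; first by
    rewrite /= ?(mevalB, mevalD, mevalZ, mevalM, rmorphXn) /= ?mevalXU;
    rewrite ?(expr2, mulr0, subr0, addr0)).
  by [].
- move=> a p q /asboolP[c ->] /asboolP[e ->]; apply/asboolP.
  exists (fun i => a * c i + e i).
  rewrite mulr_sumr -big_split /=; apply: eq_bigr => i _.
  by rewrite mulrDl mulrA.
Qed.

HB.instance Definition _ (k : fieldType) (alpha : k) :=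
  isIdealr.Build {mpoly k[6]} (idealI alpha) (idealI_closed alpha).

Definition ringR (k : fieldType) (alpha : k) : comNzRingType :=
  {ideal_quot (idealI alpha)}.

Definition res (k : fieldType) (alpha : k) (p : {mpoly k[6]}) : ringR alpha :=
  \pi_({ideal_quot (idealI alpha)})%qT p.

Definition maxid (k : fieldType) (alpha : k) : {pred ringR alpha} :=
  ideal_gen [:: res alpha (varT k); res alpha (varU k); res alpha (varV k);
                res alpha (varX k); res alpha (varY k); res alpha (varZ k)].
Arguments maxid {k} alpha _.

Definition mx_of_rows (A : nzRingType) (m n : nat) (s : seq (seq A)) :
    'M[A]_(m, n) :=
  \matrix_(i < m, j < n) (nth [::] s i)`_j.

Definition d_nonpos (k : fieldType) (alpha : k) (i : int) :
    'M[ringR alpha]_(2, 2) :=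
  mx_of_rows 2 2
    [:: [:: res alpha (varV k);                        res alpha (varY k)];
        [:: res alpha ((alpha ^ (1 - i)) *: varX k);   res alpha (varZ k)]].

Definition d_one (k : fieldType) (alpha : k) : 'M[ringR alpha]_(2, 3) :=
  mx_of_rows 2 3
    [:: [:: res alpha (varV k); res alpha (varY k); 0];
        [:: res alpha (varX k); res alpha (varZ k);
            res alpha (varT k * varV k)]].

(* Only the values [beta n] with [n >= 2] matter. *)
Definition res_rank (beta : nat -> nat) (n : nat) : nat :=
  match n with 0 => 2 | 1 => 3 | _ => beta n end.

Definition C_rank (beta : nat -> nat) (i : int) : nat :=
  match i with Posz n => res_rank beta n | Negz _ => 2 end.

(* [d n] is the differential [d_(n + 2)]. *)
Definition res_diff (k : fieldType) (alpha : k) (beta : nat -> nat)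
    (d : forall n : nat,
      'M[ringR alpha]_(res_rank beta n.+1, res_rank beta n.+2)) (n : nat) :
    'M[ringR alpha]_(res_rank beta n, res_rank beta n.+1) :=
  match n with 0 => d_one alpha | n'.+1 => d n' end.

Definition C_mod (k : fieldType) (alpha : k) (beta : nat -> nat) (i : int) :
    lmodType (ringR alpha) :=
  'cV[ringR alpha]_(C_rank beta i).

Definition C_mx (k : fieldType) (alpha : k) (beta : nat -> nat)
    (d : forall n : nat,
      'M[ringR alpha]_(res_rank beta n.+1, res_rank beta n.+2)) (i : int) :
    'M[ringR alpha]_(C_rank beta (i - 1), C_rank beta i) :=
  match i with
  | Posz 0 => d_nonpos alpha 0
  | Posz 1 => d_one alpha
  | Posz n.+2 => d n
  | Negz n => d_nonpos alpha (Negz n)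
  end.

Definition C_diff (k : fieldType) (alpha : k) (beta : nat -> nat)
    (d : forall n : nat,
      'M[ringR alpha]_(res_rank beta n.+1, res_rank beta n.+2)) (i : int) :
    {linear C_mod alpha beta i -> C_mod alpha beta (i - 1)} :=
  mulmx (C_mx d i).

(* Main.v *)
Require Import Defs.
From HB Require Import structures.
From mathcomp Require Import all_boot all_order all_algebra.
From mathcomp Require Import mpoly.
From mathcomp Require Import boolp reals.
From mathcomp Require Import ring zify.

Set Implicit Arguments.
Unset Strict Implicit.
Unset Printing Implicit Defensive.

Import Order.TTheory GRing.Theory Num.Theory.
Local Open Scope ring_scope.

(** The ring [R] is a graded Gorenstein algebra with Hilbert function
    (1, 6, 6, 1): the fourteen monomials 1; t, u, v, x, y, z; tv, tx, uv, vx,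
    vy, vz; tvx span it, and a linear form on the cubics that kills the ideal
    makes multiplication into [R_3 = k] a perfect pairing, whence their
    independence and the self-injectivity of [R].  Exactness of the dual
    complex thus follows from exactness of [C].  In non-positive degrees the
    latter is explicit: solving the linear system for a cycle requires only
    division by [alpha] and by [alpha ^ j - 1], and for the differential with
    lower left entry [x], where [alpha ^ j = 1], the third column of [d_1]
    makes up for the lost rank.

    For the growth let [s_n] be the k-dimension of the image of the n-th
    differential of a minimal resolution with ranks [r_n].  Exactness gives
    [s_(n+1) + s_n = 14 r_(n+1)].  Minimality gives [s_n <= 13 r_n] and, since
    everything but the images of the basis vectors lies in the square of the
    maximal ideal, [s_n <= r_(n+1) + 7 r_n].  Hence [r_(n+1) <= 13 r_n] and
    [r_(n+2) >= 6 r_(n+1) - 7 r_n], a recursion under which a ratio of at least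
    5/3 persists.  It holds initially because two columns of [d_1] suffice
    modulo the square of the maximal ideal, whence [r_2 >= 5]. *)

(** * Dimension bounds for subspaces and images *)

Lemma dimv_lsubmx_eq0 (F : fieldType) m p q (U : {vspace 'M[F]_(m, p + q)}) :
  (forall X, X \in U -> lsubmx X = 0) -> (\dim U <= m * q)%N.
Proof.
move=> U0; have <- : dim 'M[F]_(m, q) = (m * q)%N by []; rewrite -dimvf.
rewrite -(limg_dim_eq (f := linfun (@rsubmx F m p q)) (U := U)).
  by rewrite dimvS ?subvf.
apply/eqP; rewrite -subv0; apply/subvP => X.
rewrite memv_cap memv_ker lfunE /= => /andP[/U0 X0 /eqP X1].
by rewrite -[X]hsubmxK X0 X1 row_mx0 mem0v.
Qed.

(** The quotient of [U] by [lker g] embeds in [W], so passing from [U] to [lker g] costs at most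
    [dim W] dimensions in the image of [f]. *)
Lemma limg_dim_lker (F : fieldType) (U V W : vectType F)
    (f : 'Hom(U, V)) (g : 'Hom(U, W)) :
  (\dim (limg f) <= \dim (f @: lker g) + dim W)%N.
Proof.
have /= fE := limg_ker_dim f fullv; have /= gE := limg_ker_dim g fullv.
have hE := limg_ker_dim f (lker g); rewrite !capfv in fE gE.
have := dimvS (capvSr (lker g) (lker f)); have := dimvS (subvf (limg g)).
by rewrite -dimvf; lia.
Qed.

(** * The socle form *)

Section Socle.
Variables (k : fieldType) (alpha : k).
Local Notation P := {mpoly k[6]}.

Definition exponents (m : 'X_{1..6}) : seq nat :=
  [:: m (@Ordinal 6 0 isT); m (@Ordinal 6 1 isT); m (@Ordinal 6 2 isT);
      m (@Ordinal 6 3 isT); m (@Ordinal 6 4 isT); m (@Ordinal 6 5 isT)].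

(* The contraction of a cubic with the Macaulay inverse system of [R]: exponents
   of T, U, V, X, Y, Z, and the multiple of [tvx] that the monomial becomes
   in [R]; the cubic monomials not listed vanish in [R]. *)
Definition cubic_table : seq (seq nat * k) :=
  [:: ([:: 2; 0; 0; 0; 1; 0]%N, 1); ([:: 2; 0; 0; 0; 0; 1]%N, - (alpha + 1));
      ([:: 1; 0; 1; 1; 0; 0]%N, 1); ([:: 1; 0; 0; 1; 0; 1]%N, - alpha);
      ([:: 0; 1; 1; 0; 0; 1]%N, 1); ([:: 0; 0; 1; 2; 0; 0]%N, 1);
      ([:: 0; 0; 1; 0; 2; 0]%N, 1); ([:: 0; 0; 0; 3; 0; 0]%N, 1);
      ([:: 0; 0; 0; 2; 0; 1]%N, - alpha); ([:: 0; 0; 0; 0; 2; 1]%N, -1)].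

Definition cubic_value (e : seq nat) : k :=
  foldr (fun c r => if c.1 == e then c.2 else r) 0 cubic_table.

Definition socle_form (p : P) : k :=
  \sum_(m : 'X_{1..6 < 4}) p@_m * cubic_value (exponents m).

Fact socle_form_is_scalar : scalar socle_form.
Proof.
move=> c p q; rewrite /socle_form mulr_sumr -big_split /=.
by apply: eq_bigr => m _; rewrite mcoeffD mcoeffZ mulrDl mulrA.
Qed.

HB.instance Definition _ := GRing.isLinear.Build k P k *%R socle_form
  socle_form_is_scalar.

Lemma cubic_value_mdeg m : mdeg m != 3 -> cubic_value (exponents m) = 0.
Proof.
have -> : mdeg m = sumn (exponents m).
  rewrite mdegE !big_ord_recr big_ord0 /= !add0n addn0 !addnA.
  by do ![congr (_ + _)%N]; congr (m _); apply: val_inj.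
rewrite /cubic_value.
elim: cubic_table (isT : all (fun c => sumn c.1 == 3) cubic_table) => //.
move=> [e c] s IH /andP[e3 s3] m3; rewrite [LHS]/=.
case: eqP => [em|_]; last exact: IH.
by rewrite -em e3 in m3.
Qed.

(** For concrete indices the right-hand side is a closed list, so that lookup in [cubic_table]
    becomes a computation. *)
Lemma exponents_cubic (i j l : 'I_6) :
  exponents (U_(i) + (U_(j) + U_(l)))%MM =
  [seq ((i == p :> nat) + ((j == p :> nat) + (l == p :> nat)))%N | p <- iota 0 6].
Proof. by rewrite /exponents !mnmDE !mnm1E. Qed.

Lemma socle_formX m : socle_form 'X_[m] = cubic_value (exponents m).
Proof.
rewrite /socle_form; case: (ltnP (mdeg m) 4) => [m4|m4].
  rewrite (bigD1 (BMultinom m4)) //= mcoeffX eqxx mul1r big1 ?addr0 // => m' ne.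
  by rewrite mcoeffX eq_sym; move: ne; rewrite -val_eqE /= => /negbTE->; rewrite mul0r.
rewrite cubic_value_mdeg; last by rewrite gtn_eqF.
rewrite big1 // => m' _; rewrite mcoeffX.
have -> : (m == m') = false; last by rewrite mul0r.
by apply/eqP => mm'; move: (bmdeg m'); rewrite -mm' ltnNge m4.
Qed.

(** By linearity [p] may be taken to be a monomial. The quadrics are homogeneous, so only a variable
    times a quadric can reach degree 3; this leaves ninety evaluations of [cubic_table]. *)
Lemma socle_form_quadrics (p q : P) : q \in quadrics alpha -> socle_form (p * q) = 0.
Proof.
move=> qI; rewrite [p]mpolyE mulr_suml raddf_sum big1 //= => m _.
rewrite -scalerAl linearZ /=; suff -> : socle_form ('X_[m] * q) = 0 by rewrite mulr0.
have XX i j : socle_form ('X_[m] * ('X_i * 'X_j)) =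
    cubic_value (exponents (m + (U_(i) + U_(j)))).
  by rewrite -!mpolyXD socle_formX.
case: (boolP (mdeg m == 1%N)) => [|m1]; last first.
  have {}XX i j : socle_form ('X_[m] * ('X_i * 'X_j)) = 0.
    by rewrite XX cubic_value_mdeg // !mdegD !mdeg1 addn2 !eqSS.
  move: qI; rewrite /quadrics /varT /varU /varV /varX /varY /varZ.
  rewrite !inE; do 14?[case/orP]; move=> /eqP->;
  by rewrite ?expr2 ?mulrDr ?mulrN -?scalerAr ?(linearD, linearN, linearZ) /= !XX
    ?(mulr0, oppr0, addr0).
rewrite mdeg_eq1 => /existsP[[i lti] /eqP mE]; rewrite {m}mE in XX *.
have {}XX j l := etrans (XX j l) (congr1 cubic_value (exponents_cubic _ j l)).
move: qI; rewrite /quadrics /varT /varU /varV /varX /varY /varZ.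
do 6?[case: i lti XX => [|i] lti XX //];
  rewrite !inE; do 14?[case/orP]; move=> /eqP->;
  rewrite ?expr2 ?mulrDr ?mulrN -?scalerAr ?(linearD, linearN, linearZ) /= !XX;
  rewrite /cubic_value /=.
all: ring.
Qed.
End Socle.

(** * A basis of the ring *)

Section Ring.
Variables (k : fieldType) (alpha : k).
Local Notation A := (ringR alpha).

Definition cst (c : k) : A := res alpha c%:MP.

HB.instance Definition _ := GRing.RMorphism.copy (res alpha)
  (\pi_({ideal_quot (idealI alpha)})%qT : {mpoly k[6]} -> A).
HB.instance Definition _ := GRing.RMorphism.copy cst
  (res alpha \o @mpolyC 6 k).

Lemma resZ c p : res alpha (c *: p) = cst c * res alpha p.
Proof. by rewrite -mul_mpolyC rmorphM. Qed.

Lemma res_eq0 p : (res alpha p == 0) = (p \in idealI alpha).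
Proof.
by rewrite -[p in RHS]subr0 Quotient.idealrBE -[0 in LHS](rmorph0 (res alpha)).
Qed.

Definition socle_coord (a : A) : k := socle_form alpha (repr a).

(** Independence of the chosen representative: two of them differ by an element of the ideal, which
    [socle_form] kills. *)
Lemma socle_coord_res p : socle_coord (res alpha p) = socle_form alpha p.
Proof.
apply/eqP; rewrite -subr_eq0 -raddfB; set q := _ - p.
have : q \in idealI alpha by rewrite Quotient.idealrBE reprK.
move=> /asboolP[c ->]; rewrite raddf_sum big1 //= => i _.
by rewrite socle_form_quadrics // mem_nth.
Qed.

Lemma resP (a : A) : exists p, a = res alpha p.
Proof. by exists (repr a); rewrite /res reprK. Qed.

Lemma socle_coord_is_additive : zmod_morphism socle_coord.
Proof.
move=> a b; have [p ->] := resP a; have [q ->] := resP b.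
by rewrite -rmorphB !socle_coord_res raddfB.
Qed.

HB.instance Definition _ := GRing.isZmodMorphism.Build A k socle_coord
  socle_coord_is_additive.

Lemma socle_coordZ c a : socle_coord (cst c * a) = c * socle_coord a.
Proof. by have [p ->] := resP a; rewrite -resZ !socle_coord_res linearZ. Qed.

Local Notation t := (res alpha (varT k)).
Local Notation u := (res alpha (varU k)).
Local Notation v := (res alpha (varV k)).
Local Notation x := (res alpha (varX k)).
Local Notation y := (res alpha (varY k)).
Local Notation z := (res alpha (varZ k)).
Local Notation al := (cst alpha).

(** These are the defining relations, numbered as in [quadrics]; keeping them as named expressions
    lets [ring] verify a combination of them before each is replaced by 0. *)
Definition Q (j : nat) : A :=
  [:: z ^+ 2; u * z - t * x - al * (u * v); u ^+ 2; y * z + v * y; u * y;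
      y ^+ 2 - t * x - (al - 1) * (u * v); x * z + al * (v * x); u * x; x * y;
      x ^+ 2 - t * x - t * v; t * z + t * y + al * (v * x); t * u;
      t * y - v * x + t * v; t ^+ 2 + (al + 1) * (u * v) - v * y; v ^+ 2]`_j.

Lemma Q_eq0 j : Q j = 0.
Proof.
case: (ltnP j 15) => j15; last by rewrite /Q nth_default.
have -> : Q j = res alpha (quadrics alpha)`_j.
  rewrite -(nth_map _ 0 (res alpha)) //=; congr nth.
  rewrite !(rmorphD, rmorphB, rmorphXn, rmorphM, rmorphN, rmorph1) /=.
  by rewrite !resZ !(rmorphD, rmorphB, rmorphM, rmorphN1, rmorph1).
apply/eqP; rewrite res_eq0; apply/asboolP.
exists (fun i => (i == Ordinal j15)%:R).
rewrite (bigD1 (Ordinal j15)) //= eqxx mul1r big1 ?addr0 // => i /negbTE->.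
by rewrite mul0r.
Qed.

(* All coordinate vectors refer to this order, which is by degree. *)
Definition basis : seq A :=
  [:: 1; t; u; v; x; y; z; t * v; t * x; u * v; v * x; v * y; v * z; t * v * x].

Definition of_coord (r : 'rV[k]_14) : A := \sum_j cst (r 0 j) * basis`_j.

Definition elt (l : seq k) : A := of_coord (\row_j l`_j).

Lemma eltE c0 ct cu cv cx cy cz ctv ctx cuv cvx cvy cvz cs :
  elt [:: c0; ct; cu; cv; cx; cy; cz; ctv; ctx; cuv; cvx; cvy; cvz; cs] =
  cst c0 * 1 + cst ct * t + cst cu * u + cst cv * v + cst cx * x + cst cy * y +
  cst cz * z + cst ctv * (t * v) + cst ctx * (t * x) + cst cuv * (u * v) +
  cst cvx * (v * x) + cst cvy * (v * y) + cst cvz * (v * z) +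
  cst cs * (t * v * x).
Proof. by rewrite /elt /of_coord !big_ord_recr big_ord0 /= add0r !mxE. Qed.

(* In each of the following six proofs the difference of the two sides is exhibited as a
   combination of the defining quadrics. *)
Lemma mul_t c0 ct cu cv cx cy cz ctv ctx cuv cvx cvy cvz cs :
  t * elt [:: c0; ct; cu; cv; cx; cy; cz; ctv; ctx; cuv; cvx; cvy; cvz; cs] =
  elt [:: 0; c0; 0; 0; 0; 0; 0; cv - cy + cz; cx; -(alpha + 1) * ct;
         cy - (1 + alpha) * cz; ct; 0; cvx].
Proof.
rewrite !eltE; apply: subr0_eq.
transitivity (
    cst ct * Q 13 + cst cu * Q 11 + cst cy * Q 12 + cst cz * (Q 10 - Q 12) +
    cst ctv * (v * Q 13 - (al + 1) * u * Q 14 + y * Q 14) +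
    cst ctx * (x * Q 13 - (al + 1) * v * Q 7 + v * Q 8) + cst cuv * (v * Q 11) +
    cst cvy * (v * Q 12 + x * Q 14 - t * Q 14) +
    cst cvz * (v * Q 10 - (v * Q 12 + x * Q 14 - t * Q 14) - al * x * Q 14) +
    cst cs * (x * (v * Q 13 - (al + 1) * u * Q 14 + y * Q 14))).
  by rewrite /Q /=; ring.
by rewrite !Q_eq0 ?(mulr0, subr0, addr0).
Qed.

Lemma mul_u c0 ct cu cv cx cy cz ctv ctx cuv cvx cvy cvz cs :
  u * elt [:: c0; ct; cu; cv; cx; cy; cz; ctv; ctx; cuv; cvx; cvy; cvz; cs] =
  elt [:: 0; 0; c0; 0; 0; 0; 0; 0; cz; cv + alpha * cz; 0; 0; 0; cvz].
Proof.
rewrite !eltE; apply: subr0_eq.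
transitivity (
    cst ct * Q 11 + cst cu * Q 2 + cst cx * Q 7 + cst cy * Q 4 + cst cz * Q 1 +
    cst ctv * (v * Q 11) + cst ctx * (x * Q 11) + cst cuv * (v * Q 2) +
    cst cvx * (v * Q 7) + cst cvy * (v * Q 4) +
    cst cvz * (v * Q 1 + al * u * Q 14) + cst cs * (v * x * Q 11)).
  by rewrite /Q /=; ring.
by rewrite !Q_eq0 ?(mulr0, subr0, addr0).
Qed.

Lemma mul_v c0 ct cu cv cx cy cz ctv ctx cuv cvx cvy cvz cs :
  v * elt [:: c0; ct; cu; cv; cx; cy; cz; ctv; ctx; cuv; cvx; cvy; cvz; cs] =
  elt [:: 0; 0; 0; c0; 0; 0; 0; ct; 0; cu; cx; cy; cz; ctx].
Proof.
rewrite !eltE; apply: subr0_eq.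
transitivity (
    cst cv * Q 14 + cst ctv * (t * Q 14) + cst cuv * (u * Q 14) +
    cst cvx * (x * Q 14) + cst cvy * (y * Q 14) + cst cvz * (z * Q 14) +
    cst cs * (t * x * Q 14)).
  by rewrite /Q /=; ring.
by rewrite !Q_eq0 ?(mulr0, subr0, addr0).
Qed.

Lemma mul_x c0 ct cu cv cx cy cz ctv ctx cuv cvx cvy cvz cs :
  x * elt [:: c0; ct; cu; cv; cx; cy; cz; ctv; ctx; cuv; cvx; cvy; cvz; cs] =
  elt [:: 0; 0; 0; 0; c0; 0; 0; cx; ct + cx; 0; cv - alpha * cz; 0; 0;
         ctv + cvx].
Proof.
rewrite !eltE; apply: subr0_eq.
transitivity (
    cst cu * Q 7 + cst cx * Q 9 + cst cy * Q 8 + cst cz * Q 6 +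
    cst ctx * (t * Q 9 + (x * Q 13 - (al + 1) * v * Q 7 + v * Q 8) + (v * Q 13
      - (al + 1) * u * Q 14 + y * Q 14)) +
    cst cuv * (v * Q 7) + cst cvx * (v * Q 9 + t * Q 14) + cst cvy * (v * Q 8) +
    cst cvz * (v * Q 6 - al * x * Q 14) +
    cst cs * (v * (t * Q 9 + (x * Q 13 - (al + 1) * v * Q 7 + v * Q 8) +
      (v * Q 13 - (al + 1) * u * Q 14 + y * Q 14)))).
  by rewrite /Q /=; ring.
by rewrite !Q_eq0 ?(mulr0, subr0, addr0).
Qed.

Lemma mul_y c0 ct cu cv cx cy cz ctv ctx cuv cvx cvy cvz cs :
  y * elt [:: c0; ct; cu; cv; cx; cy; cz; ctv; ctx; cuv; cvx; cvy; cvz; cs] =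
  elt [:: 0; 0; 0; 0; 0; c0; 0; -ct; cy; (alpha - 1) * cy; ct; cv - cz; 0; cvy].
Proof.
rewrite !eltE; apply: subr0_eq.
transitivity (
    cst ct * Q 12 + cst cu * Q 4 + cst cx * Q 8 + cst cy * Q 5 + cst cz * Q 3 +
    cst ctv * (v * Q 12 + x * Q 14 - t * Q 14) + cst ctx * (t * Q 8) +
    cst cuv * (v * Q 4) + cst cvx * (v * Q 8) +
    cst cvy * (v * Q 5 + (al - 1) * u * Q 14) + cst cvz * (v * Q 3 - y * Q 14) +
    cst cs * (t * v * Q 8)).
  by rewrite /Q /=; ring.
by rewrite !Q_eq0 ?(mulr0, subr0, addr0).
Qed.

Lemma mul_z c0 ct cu cv cx cy cz ctv ctx cuv cvx cvy cvz cs :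
  z * elt [:: c0; ct; cu; cv; cx; cy; cz; ctv; ctx; cuv; cvx; cvy; cvz; cs] =
  elt [:: 0; 0; 0; 0; 0; 0; c0; ct; cu; alpha * cu;
         -(1 + alpha) * ct - alpha * cx; -cy; cv; -alpha * ctx + cuv].
Proof.
rewrite !eltE; apply: subr0_eq.
transitivity (
    cst ct * (Q 10 - Q 12) + cst cu * Q 1 + cst cx * Q 6 + cst cy * Q 3 +
    cst cz * Q 0 +
    cst ctv * (v * Q 10 - (v * Q 12 + x * Q 14 - t * Q 14) - al * x * Q 14) +
    cst ctx * (t * Q 6) + cst cuv * (v * Q 1 + al * u * Q 14) +
    cst cvx * (v * Q 6 - al * x * Q 14) + cst cvy * (v * Q 3 - y * Q 14) +
    cst cvz * (v * Q 0) + cst cs * (t * v * Q 6 - al * t * x * Q 14)).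
  by rewrite /Q /=; ring.
by rewrite !Q_eq0 ?(mulr0, subr0, addr0).
Qed.

(** Thirteen of the basis monomials have degree below 3, where the form vanishes, and [tvx] has
    value 1 in [cubic_table]. *)
Lemma socle_coord_elt c0 ct cu cv cx cy cz ctv ctx cuv cvx cvy cvz cs :
  socle_coord (elt [:: c0; ct; cu; cv; cx; cy; cz; ctv; ctx; cuv; cvx; cvy; cvz; cs])
  = cs.
Proof.
have X0 p : socle_coord (res alpha 'X_[p]) = cubic_value alpha (exponents p).
  by rewrite socle_coord_res socle_formX.
have X1 : socle_coord (1 : A) = 0.
  by rewrite -(rmorph1 (res alpha)) /= -mpolyX0 X0 cubic_value_mdeg // mdeg0.
have X2 i : socle_coord (res alpha 'X_i) = 0 by rewrite X0 cubic_value_mdeg // mdeg1.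
have X3 i j : socle_coord (res alpha 'X_i * res alpha 'X_j) = 0.
  by rewrite -rmorphM /= -mpolyXD X0 cubic_value_mdeg // mdegD !mdeg1.
have X4 : socle_coord (t * v * x) = 1.
  by rewrite -mulrA -!rmorphM /= -!mpolyXD X0 exponents_cubic.
by rewrite eltE !raddfD /= !socle_coordZ X1 X4 !X2 !X3 !mulr0 !add0r mulr1.
Qed.

Fact of_coord_is_additive : zmod_morphism of_coord.
Proof.
move=> r s; rewrite /of_coord -sumrB; apply: eq_bigr => j _.
by rewrite !mxE rmorphB mulrBl.
Qed.

HB.instance Definition _ := GRing.isZmodMorphism.Build 'rV[k]_14 A of_coord
  of_coord_is_additive.

Lemma of_coordZ c r : of_coord (c *: r) = cst c * of_coord r.
Proof.
rewrite /of_coord mulr_sumr; apply: eq_bigr => j _.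
by rewrite mxE rmorphM mulrA.
Qed.

(** Case analysis on this predicate names the fourteen coefficients of a ring element, in the form
    to which the multiplication table applies. *)
Variant elt_spec : A -> Prop :=
  EltSpec c0 ct cu cv cx cy cz ctv ctx cuv cvx cvy cvz cs :
    elt_spec (elt [:: c0; ct; cu; cv; cx; cy; cz; ctv; ctx; cuv; cvx; cvy; cvz; cs]).

Lemma of_coordP r : elt_spec (of_coord r).
Proof.
suff -> : of_coord r = elt [seq r 0 (inord j) | j <- iota 0 14] by constructor.
congr of_coord; apply/rowP => j.
by rewrite mxE (nth_map 0) ?size_iota // nth_iota // inord_val.
Qed.

(** The span of [basis] contains 1 and, by the multiplication table, is stable under multiplication
    by each variable; hence it contains every monomial. *)
Lemma of_coord_surj a : exists r, a = of_coord r.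
Proof.
pose S (b : A) := exists r, b = of_coord r.
have SD b c : S b -> S c -> S (b + c).
  by move=> [r ->] [s ->]; exists (r + s); rewrite raddfD.
have SZ c b : S b -> S (cst c * b) by move=> [r ->]; exists (c *: r); rewrite of_coordZ.
have SX i b : S b -> S (res alpha 'X_i * b).
  move=> [r ->]; case: (of_coordP r) => *.
  case: i => i lti; do 6?[case: i lti => [|i] lti //];
    rewrite (bool_irrelevance lti isT).
  - by rewrite mul_t; eexists.
  - by rewrite mul_u; eexists.
  - by rewrite mul_v; eexists.
  - by rewrite mul_x; eexists.
  - by rewrite mul_y; eexists.
  - by rewrite mul_z; eexists.
have S1 : S 1.
  exists (\row_j [:: 1; 0; 0; 0; 0; 0; 0; 0; 0; 0; 0; 0; 0; 0]`_j).
  by rewrite [RHS]eltE !rmorph0 !mul0r !addr0 rmorph1 mulr1.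
have S0 : S 0 by exists 0; rewrite raddf0.
have [p ->] := resP a; rewrite [p]mpolyE rmorph_sum /=.
apply: (big_ind S) => // m _; rewrite resZ; apply: SZ.
rewrite mpolyXE_id rmorph_prod /=.
(* [S] is not yet known to be closed under products, so the induction shows instead that
   multiplication by each partial product preserves [S]. *)
rewrite -[X in S X]mulr1.
apply: (big_ind (fun b => forall c, S c -> S (b * c))) => //
  [c|b c Sb Sc d Sd|i _ b Sb].
- by rewrite mul1r.
- by rewrite -mulrA; apply/Sb/Sc.
rewrite rmorphXn /=; elim: (m i) => [|n IH]; rewrite ?mul1r // exprS -mulrA.
exact: SX.
Qed.

Lemma eltP a : elt_spec a.
Proof. by have [r ->] := of_coord_surj a; apply: of_coordP. Qed.

(* Dual to [basis] under the pairing [socle_coord (b * c)]. *)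
Definition dual_basis : seq A :=
  [:: t * v * x; v * x - t * v; v * z; t * x + al * (u * v); t * v; v * y; u * v;
      x - t; v; z + al * v; t; y; u; 1].

Definition coord (b : A) : 'rV[k]_14 := \row_j socle_coord (b * dual_basis`_j).

Fact coord_is_additive : zmod_morphism coord.
Proof. by move=> b c; apply/rowP => j; rewrite !mxE mulrBl raddfB. Qed.

HB.instance Definition _ := GRing.isZmodMorphism.Build A 'rV[k]_14 coord
  coord_is_additive.

Lemma coordZ c b : coord (cst c * b) = c *: coord b.
Proof. by apply/rowP => j; rewrite !mxE -mulrA socle_coordZ. Qed.

(** Linear independence of [basis]: by the multiplication table its pairing with [dual_basis] is the
    identity matrix. *)
Lemma of_coordK : cancel of_coord coord.
Proof.
move=> r; have [l -> sl]: exists2 l, r = \row_j l`_j & size l = 14%N.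
  exists [seq r 0 (inord j) | j <- iota 0 14] => //.
  by apply/rowP => j; rewrite mxE (nth_map 0) ?size_iota // nth_iota // inord_val.
do 14![case: l sl => [|? l] // sl]; case: l sl => // _.
apply/rowP => -[j ltj]; rewrite 2!mxE -/(elt _).
do 14?[case: j ltj => [|j] ltj //=];
  rewrite ?(mulrDr, mulrN, mulr1) ?(mulrC (elt _)) -?mulrA;
  rewrite ?(mul_t, mul_u, mul_v, mul_x, mul_y, mul_z);
  rewrite ?(raddfD, raddfN) /= ?socle_coordZ ?socle_coord_elt; ring.
Qed.

Lemma coordK : cancel coord of_coord.
Proof. by move=> b; have [r ->] := of_coord_surj b; rewrite of_coordK. Qed.

Lemma elt_inj l l' : size l = 14%N -> size l' = 14%N -> elt l = elt l' -> l = l'.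
Proof.
move=> sl sl' /(congr1 coord); rewrite !of_coordK => /rowP ll'.
apply: (@eq_from_nth _ 0); rewrite sl ?sl' // => j ltj.
by have := ll' (Ordinal ltj); rewrite !mxE.
Qed.

(** * Exactness in non-positive degrees *)

(** Consecutive differentials compose to zero: [g] is the scalar at [x] in the one applied first,
    and [r] is the coefficient of the third column of [d_one]. Both components are combinations of
    the relations [Q j]. *)
Lemma pencil_comp g p q r :
  let f := v * p + y * q in let h := cst g * x * p + z * q + t * v * r in
  v * f + y * h = 0 /\ cst (alpha * g) * x * f + z * h = 0.
Proof.
move=> f h; split.
- transitivity (p * (Q 14 + cst g * Q 8) + q * Q 3 +
                r * (v * Q 12 + x * Q 14 - t * Q 14)).
    by rewrite /f /h /Q /=; ring.
  by rewrite !Q_eq0 ?(mulr0, subr0, addr0).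
transitivity (p * cst g * Q 6 + q * (al * cst g * Q 8 + Q 0) +
  r * (v * Q 10 - (v * Q 12 + x * Q 14 - t * Q 14) -
       al * x * Q 14)).
  by rewrite /f /h /Q /=; ring.
by rewrite !Q_eq0 ?(mulr0, subr0, addr0).
Qed.

Lemma eltD l l' : elt l + elt l' = elt [seq l`_j + l'`_j | j <- iota 0 14].
Proof.
rewrite -raddfD; congr of_coord; apply/rowP => j.
by rewrite !mxE (nth_map 0) ?size_iota // nth_iota.
Qed.

Lemma eltZ c l : cst c * elt l = elt [seq c * l`_j | j <- iota 0 14].
Proof.
rewrite -of_coordZ; congr of_coord; apply/rowP => j.
by rewrite !mxE (nth_map 0) ?size_iota // nth_iota.
Qed.

Lemma elt_eq0 l : size l = 14%N -> elt l = 0 -> l = nseq 14 0.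
Proof.
move=> sl l0; apply: (elt_inj sl (size_nseq _ _) (etrans l0 _)).
rewrite -(raddf0 of_coord); congr of_coord; apply/rowP => j.
by rewrite !mxE nth_nseq if_same.
Qed.

(* The multiple of [tv], needed only for [g = 1], is the contribution of the third
   column of [d_1]. *)
Lemma pencil_exact g f h : alpha != 0 -> alpha * g != 1 ->
  v * f + y * h = 0 -> cst (alpha * g) * x * f + z * h = 0 ->
  exists p q c, [/\ f = v * p + y * q, h = cst g * x * p + z * q + t * v * cst c
                  & g != 1 -> c = 0].
Proof.
move=> al0 ag1.
case: f / (eltP f) => f0 ft fu fv fx fy fz ftv ftx fuv fvx fvy fvz fs.
case: h / (eltP h) => h0 ht hu hv hx hy hz htv htx huv hvx hvy hvz hs.
rewrite -!mulrA mul_v mul_y mul_x mul_z eltZ !eltD /= => /elt_eq0 E1 /elt_eq0 E2.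
have {E1} := E1 erefl; have {E2} := E2 erefl.
case=> _ _ _ _ _ _ _ e1 e2 e3 e4 e5 e6 e7.
case=> _ _ _ e8 _ e9 _ e10 e11 e12 e13 e14 e15 e16.
have {e8}f0E : f0 = 0 by rewrite -e8 addr0.
have {e9}h0E : h0 = 0 by rewrite -e9 add0r.
have {e11 e5}hyE : hy = 0 by rewrite -e11 add0r.
have {e15}fzE : fz = 0 by rewrite -e15 addr0.
have {e6}hvE : hv = 0 by rewrite -e6 mulr0 add0r.
have {e12}fuE : fu = 0 by rewrite -e12 hyE mulr0 addr0.
have {e3}huE : hu = 0.
  by apply/eqP; move/eqP: e3; rewrite mulr0 add0r mulf_eq0 (negbTE al0).
(* The coefficient of [vx] in the first equation and that of [tv] in the second give [fx + ht = 0]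
   and [alpha * g * fx + ht = 0]; here [alpha * g != 1] enters. *)
have {e1}fxE : fx = 0.
  apply/eqP; have : (1 - alpha * g) * fx = 0.
    by rewrite -[RHS](subrr 0) -{1}e13 -e1; ring.
  by move/eqP; rewrite mulf_eq0 subr_eq0 eq_sym (negbTE ag1).
have {e13}htE : ht = 0 by rewrite -e13 fxE add0r.
have {e10}ftE : ft = 0 by rewrite -[RHS]e10 htE subr0.
have {e14}hzE : hz = fy by apply/eqP; rewrite eq_sym -subr_eq0 -e14 hvE add0r.
have {e4}hxE : hx = g * fv.
  apply: (mulfI al0); apply/eqP; rewrite -subr_eq0 -oppr_eq0.
  by rewrite -[X in _ == X]e4 htE fzE; apply/eqP; ring.
have {e16}hvyE : hvy = - ftx by apply/eqP; rewrite -addr_eq0 addrC e16.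
have {e7}htxE : htx = g * (ftv + fvx) + huv / alpha.
  apply: (mulfI al0); apply/eqP; rewrite -subr_eq0 -oppr_eq0.
  by rewrite -[X in _ == X]e7; apply/eqP; field.
(* The coefficient of [vx] in [f] requires [px + qt = fvx], that of [tv] in [h] requires
   [g * px + qt + c = htv]. Their difference determines [px] unless [g = 1], when [c] must absorb
   it. *)
have [px [c [pxc c0]]] : exists px c, (g - 1) * px + c = htv - fvx /\ (g != 1 -> c = 0).
  case: (eqVneq g 1) => [->|g1]; first by exists 0, (htv - fvx); rewrite mulr0 add0r.
  by exists ((htv - fvx) / (g - 1)), 0; rewrite addr0 mulrC divfK // subr_eq0.
(* [qt] and [pt] solve for the coefficients of [vx] and [tv] in [f], and [qx] for that of [vx] in
   [h]. The coordinates of the witnesses that remain free are set to 0. *)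
pose qt := fvx - px; pose pt := ftv + qt.
pose qx := - (hvx + alpha * g * fvz + (1 + alpha) * qt) / alpha.
exists (elt [:: fv; pt; fuv - (alpha - 1) * ftx; 0; px; fvy - hvz; fvz;
                0; fs; 0; 0; 0; 0; 0]).
exists (elt [:: fy; qt; huv / alpha; hvz; qx; ftx; 0;
                0; 0; hs; 0; 0; 0; 0]), c.
have -> : t * v * cst c = elt [:: 0; 0; 0; 0; 0; 0; 0; c; 0; 0; 0; 0; 0; 0].
  by rewrite eltE !rmorph0; ring.
have htvE : htv = c + fvx + (g - 1) * px.
  by rewrite addrAC -(addrC ((g - 1) * px)) pxc subrK.
split => //; rewrite -?mulrA ?mul_v ?mul_y ?mul_x ?mul_z ?eltZ !eltD /=;
  congr (elt [:: _; _; _; _; _; _; _; _; _; _; _; _; _; _]);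
  rewrite ?(f0E, h0E, hyE, fzE, hvE, fuE, huE, htE, fxE, ftE, hzE, hxE);
  rewrite ?(hvyE, htxE, htvE) /pt /qx /qt;
  by field.
Qed.

Lemma colP2 (B : nmodType) (w w' : 'cV[B]_2) :
  w 0 0 = w' 0 0 -> w 1 0 = w' 1 0 -> w = w'.
Proof.
move=> w0 w1; apply/matrixP => i j; rewrite ord1.
by case: i => -[|[|//]] lti; rewrite -?[Ordinal lti]/(0 : 'I_2);
   [move: w0 | move: w1]; congr (w _ _ = w' _ _); apply: val_inj.
Qed.

Lemma d_nonposE i (w : 'cV[A]_2) :
  ((d_nonpos alpha i *m w) 0 0 = v * w 0 0 + y * w 1 0) *
  ((d_nonpos alpha i *m w) 1 0 = cst (alpha ^ (1 - i)) * x * w 0 0 + z * w 1 0).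
Proof.
rewrite !mxE !big_ord_recl !big_ord0 !mxE /= !addr0 -resZ.
by split; congr (_ + _ * w _ _); apply: val_inj.
Qed.

Lemma d_oneE (w : 'cV[A]_3) :
  ((d_one alpha *m w) 0 0 = v * w 0 0 + y * w 1 0) *
  ((d_one alpha *m w) 1 0 = x * w 0 0 + z * w 1 0 + t * v * w 2 0).
Proof.
rewrite !mxE !big_ord_recl !big_ord0 !mxE /= mul0r !addr0 -rmorphM addrA.
split; first by congr (_ + _ * w _ _); apply: val_inj.
by congr (_ + _ * w _ _ + _ * w _ _); apply: val_inj.
Qed.

Lemma expz_mult_order (i : int) : infinite_mult_order alpha -> i <= 0 ->
  alpha ^ (1 - i) != 1.
Proof.
by case: i => [[|n]|n] // [al0 al1] _; rewrite ?subr0 ?NegzE ?opprK -?PoszD al1.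
Qed.

(** Lowering the degree by one multiplies the entry at [x] by [alpha], so this is the pencil with
    [g = alpha ^ (1 - i)]. Neither [g] nor [alpha * g] is 1, so no third column is needed. *)
Lemma exact_d_nonpos (i : int) : infinite_mult_order alpha -> i <= 0 ->
  exact_pair (mulmx (d_nonpos alpha i) : {linear 'cV_2 -> 'cV_2})
    (mulmx (d_nonpos alpha (i - 1)) : {linear 'cV_2 -> 'cV_2}).
Proof.
move=> halpha i0 w; have [al0 _] := halpha.
have ag : alpha ^ (1 - (i - 1)) = alpha * alpha ^ (1 - i).
  by rewrite -{2}[alpha]expr1z -expfzDr // opprB.
split=> [/matrixP w0 | [w' <-]].
  have [|||p [q [c [fE hE c0]]]] :=
    pencil_exact (g := alpha ^ (1 - i)) (f := w 0 0) (h := w 1 0) al0.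
  - by rewrite -ag expz_mult_order // (le_trans _ i0) // gerBl.
  - by have := w0 0 0; rewrite d_nonposE mxE.
  - by have := w0 1 0; rewrite d_nonposE mxE ag.
  exists (\col_j [:: p; q]`_j); apply: colP2; rewrite d_nonposE !mxE /= ?fE ?hE //.
  by rewrite c0 ?expz_mult_order // rmorph0 mulr0 addr0.
have := pencil_comp (alpha ^ (1 - i)) (w' 0 0) (w' 1 0) 0.
rewrite mulr0 addr0 => -[e0 e1].
by apply: colP2; rewrite d_nonposE !d_nonposE mxE ?ag.
Qed.

(** This is the pencil with [g = 1]; the coefficient [c] of [pencil_exact] becomes the third entry
    of the preimage. *)
Lemma exact_d_one : infinite_mult_order alpha ->
  exact_pair (mulmx (d_one alpha) : {linear 'cV_3 -> 'cV_2})
    (mulmx (d_nonpos alpha 0) : {linear 'cV_2 -> 'cV_2}).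
Proof.
move=> halpha w; have [al0 _] := halpha.
have ag : alpha ^ (1 - 0) = alpha * 1 by rewrite subr0 mulr1.
split=> [/matrixP w0 | [w' <-]].
  have [|||p [q [c [fE hE _]]]] :=
    pencil_exact (g := 1) (f := w 0 0) (h := w 1 0) al0.
  - by rewrite -ag expz_mult_order.
  - by have := w0 0 0; rewrite d_nonposE mxE.
  - by have := w0 1 0; rewrite d_nonposE mxE ag.
  exists (\col_j [:: p; q; cst c]`_j); apply: colP2; rewrite d_oneE !mxE /= ?fE ?hE //.
  by rewrite rmorph1 mul1r.
have := pencil_comp 1 (w' 0 0) (w' 1 0) (w' 2 0).
rewrite rmorph1 mul1r => -[e0 e1].
by apply: colP2; rewrite d_nonposE !d_oneE mxE ?ag.
Qed.

(** * Linear algebra over the base field, and self-duality *)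

(** Row [i] holds the coordinates of entry [i]; maps of [A]-columns thereby become [k]-linear maps
    of matrices, to which rank-nullity applies. *)
Definition flat n (w : 'cV[A]_n) : 'M[k]_(n, 14) := \matrix_(i, j) coord (w i 0) 0 j.
Definition unflat n (X : 'M[k]_(n, 14)) : 'cV[A]_n := \col_i of_coord (row i X).

Lemma flatK n : cancel (@flat n) (@unflat n).
Proof.
move=> w; apply/colP => i; rewrite mxE -[RHS]coordK; congr of_coord.
by apply/rowP => j; rewrite !mxE.
Qed.

Lemma unflatK n : cancel (@unflat n) (@flat n).
Proof.
by move=> X; apply/matrixP => i j; rewrite mxE [unflat X i 0]mxE of_coordK mxE.
Qed.

Lemma row_flat n (w : 'cV[A]_n) i : row i (flat w) = coord (w i 0).
Proof. by apply/rowP => j; rewrite !mxE. Qed.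

Lemma unflat_linear n c (X Y : 'M[k]_(n, 14)) :
  unflat (c *: X + Y) = cst c *: unflat X + unflat Y.
Proof.
by apply/colP => i; rewrite !mxE linearP raddfD /= of_coordZ.
Qed.

Lemma flat_linear n c (w w' : 'cV[A]_n) :
  flat (cst c *: w + w') = c *: flat w + flat w'.
Proof. by rewrite -[RHS]unflatK unflat_linear !flatK. Qed.

Lemma flat0 n : flat (0 : 'cV[A]_n) = 0.
Proof. by apply/row_matrixP => i; rewrite row_flat mxE row0 raddf0. Qed.

Definition act m n (D : 'M[A]_(m, n)) (X : 'M[k]_(n, 14)) : 'M[k]_(m, 14) :=
  flat (D *m unflat X).

Fact act_is_linear m n (D : 'M[A]_(m, n)) : linear (act D).
Proof.
by move=> c X Y; rewrite /act unflat_linear mulmxDr -scalemxAr flat_linear.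
Qed.

HB.instance Definition _ m n (D : 'M[A]_(m, n)) :=
  GRing.isLinear.Build k 'M[k]_(n, 14) 'M[k]_(m, 14) *:%R (act D) (act_is_linear D).

Definition hom m n (D : 'M[A]_(m, n)) := linfun (act D).

Lemma hom_flat m n (D : 'M[A]_(m, n)) w : hom D (flat w) = flat (D *m w).
Proof. by rewrite lfunE /= /act flatK. Qed.

Lemma limg_hom_lker m n p (D : 'M[A]_(m, n)) (E : 'M[A]_(n, p)) :
  exact_pair (mulmx E : {linear 'cV_p -> 'cV_n}) (mulmx D : {linear 'cV_n -> 'cV_m}) ->
  limg (hom E) = lker (hom D).
Proof.
move=> DE; apply/vspaceP => X; rewrite -[X]unflatK memv_ker hom_flat.
rewrite -(flat0 m) (can_eq (@flatK m)); apply/memv_imgP/eqP => [[Y _]|].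
  rewrite -[Y]unflatK hom_flat => /(can_inj (@flatK n)) ->.
  by apply/DE; eexists.
by move=> /DE[w <-]; exists (flat w); rewrite ?memvf // hom_flat.
Qed.

Definition mxdim m n (D : 'M[A]_(m, n)) := \dim (limg (hom D)).

Lemma mxdim_exact m n p (D : 'M[A]_(m, n)) (E : 'M[A]_(n, p)) :
  exact_pair (mulmx E : {linear 'cV_p -> 'cV_n}) (mulmx D : {linear 'cV_n -> 'cV_m}) ->
  (mxdim E + mxdim D = n * 14)%N.
Proof.
move=> DE; rewrite /mxdim (limg_hom_lker DE).
by have := limg_ker_dim (hom D) fullv; rewrite capfv dimvf.
Qed.

Lemma socle_coord_inj (b c : A) :
  (forall d, socle_coord (b * d) = socle_coord (c * d)) -> b = c.
Proof.
move=> bc; rewrite -[b]coordK -[c]coordK; congr of_coord.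
by apply/rowP => j; rewrite !mxE.
Qed.

Lemma socle_pairing d0 dt du dv dx dy dz dtv dtx duv dvx dvy dvz ds
    c0 ct cu cv cx cy cz ctv ctx cuv cvx cvy cvz cs :
  socle_coord (elt [:: d0; dt; du; dv; dx; dy; dz; dtv; dtx; duv; dvx; dvy; dvz; ds] *
    elt [:: c0; ct; cu; cv; cx; cy; cz; ctv; ctx; cuv; cvx; cvy; cvz; cs]) =
  d0 * cs + dt * cvx + du * cvz + dv * ctx + dx * (ctv + cvx) + dy * cvy +
  dz * (cuv - alpha * ctx) + dtv * cx + dtx * (cv - alpha * cz) + duv * cz +
  dvx * (ct + cx) + dvy * cy + dvz * cu + ds * c0.
Proof.
rewrite {1}eltE !mulrDl !raddfD /= -!(mulrA (cst _)) !socle_coordZ -!mulrA mul1r.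
by rewrite !(mul_t, mul_u, mul_v, mul_x, mul_y, mul_z) !socle_coord_elt; ring.
Qed.

Lemma socle_coord_riesz (phi : {scalar 'rV[k]_14}) :
  exists b : A, forall c : A, socle_coord (b * c) = phi (coord c).
Proof.
pose f (j : nat) := phi (coord basis`_j).
have phiE (c : A) : phi (coord c) = \sum_(j < 14) coord c 0 j * f j.
  rewrite -[in LHS](coordK c) /of_coord !raddf_sum; apply: eq_bigr => j _ /=.
  by rewrite coordZ linearZ.
(* Matching the coefficient of each coordinate of [c] in [socle_pairing] with the corresponding
   [f j] gives a triangular system for the coordinates of [b]; this is its solution. *)
exists (elt [:: f 13; f 10 - f 7; f 12; f 8 + alpha * f 9; f 7; f 11; f 9;
   f 4 - f 1; f 3; f 6 + alpha * f 3; f 1; f 5; f 2; f 0]).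
move=> c; rewrite phiE.
case: (eltP c) => c0 ct cu cv cx cy cz ctv ctx cuv cvx cvy cvz cs.
rewrite of_coordK !big_ord_recr big_ord0 /= !mxE /=.
by rewrite socle_pairing; ring.
Qed.

Lemma sum_row_delta m n (X : 'M[k]_(m, n)) : X = \sum_i delta_mx i 0 *m row i X.
Proof.
apply/matrixP => i j; rewrite summxE (bigD1 i) //= mxE big_ord1 !mxE !eqxx mul1r.
rewrite big1 ?addr0 // => l li; rewrite mxE big_ord1 !mxE.
by rewrite eq_sym (negbTE li) mul0r.
Qed.

(** The [k]-functional sending [w] to the socle coordinate of [p *m w] factors through the image of
    [D]. Extended to all columns and represented entry by entry through the perfect pairing, it
    yields [q]; nondegeneracy then turns equality of functionals into equality of rows. *)
Lemma self_injective m n (D : 'M[A]_(m, n)) (p : 'rV[A]_n) :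
  (forall w : 'cV[A]_n, D *m w = 0 -> p *m w = 0) -> exists q : 'rV[A]_m, p = q *m D.
Proof.
move=> pD.
have kerD X : hom D X = 0 -> act p X = 0.
  rewrite -[X]unflatK hom_flat => D0; rewrite /act flatK pD.
    exact: flat0.
  by apply: (can_inj (@flatK m)); rewrite D0 flat0.
have actK (w : 'cV[A]_n) : act p ((hom D)^-1%VF (hom D (flat w))) = flat (p *m w).
  apply/eqP; rewrite -subr_eq0 -{2}[w]flatK -/(act p (flat w)) -linearB /= kerD //.
  by rewrite linearB /= limg_lfunVK ?memv_img ?memvf // subrr.
(* The partial inverse of [hom D] is defined on the whole space and so extends the functional.
   Coordinate 13 is the socle coordinate, since the last entry of [dual_basis] is 1. *)
pose psi (Y : 'M[k]_(m, 14)) : k := act p ((hom D)^-1%VF Y) 0 (inord 13).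
have psi_scalar : scalar psi.
  by move=> c Y Z; rewrite /psi !linearP /= [LHS]mxE [X in X + _ = _]mxE.
pose psiL : {scalar 'M[k]_(m, 14)} :=
  HB.pack psi (GRing.isLinear.Build _ _ _ _ psi psi_scalar).
have /fin_all_exists[b bE] (i : 'I_m) : exists b : A,
    forall c : A, socle_coord (b * c) = psi (delta_mx i 0 *m coord c).
  pose phi (r : 'rV[k]_14) := psi (delta_mx i 0 *m r).
  have phi_scalar : scalar phi.
    by move=> c r s; rewrite /phi mulmxDr -scalemxAr psi_scalar.
  exact: (socle_coord_riesz
    (HB.pack phi (GRing.isLinear.Build _ _ _ _ phi phi_scalar) : {scalar 'rV[k]_14})).
exists (\row_i b i).
have qD (w : 'cV[A]_n) :
    socle_coord ((\row_i b i *m D *m w) 0 0) = socle_coord ((p *m w) 0 0).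
  rewrite -mulmxA mxE raddf_sum /=.
  have -> : socle_coord ((p *m w) 0 0) = psi (flat (D *m w)).
    rewrite -hom_flat /psi actK !mxE; congr socle_coord.
    by rewrite inordK // mulr1.
  rewrite -[psi _]/(psiL _) {1}[flat _]sum_row_delta raddf_sum; apply: eq_bigr => i _.
  by rewrite mxE bE row_flat.
apply/rowP => j; apply: socle_coord_inj => d.
(* This choice of [w] isolates entry [j] multiplied by an arbitrary [d], as nondegeneracy
   requires. *)
have := qD (d *: delta_mx j 0).
by rewrite -!scalemxAr -!colE !mxE ![d * _]mulrC => ->.
Qed.

(** * Growth *)

(* As [basis] is ordered by degree, [d = 1] gives the maximal ideal, and [d = 7] its
   square. *)
Definition vanish (d : nat) (b : A) :=
  forall j : 'I_14, (j < d)%N -> coord b 0 j = 0.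

Lemma vanishD d b c : vanish d b -> vanish d c -> vanish d (b + c).
Proof. by move=> b0 c0 j jd; rewrite raddfD mxE b0 ?c0 ?addr0. Qed.

Lemma vanish0 d : vanish d 0.
Proof. by move=> j _; rewrite raddf0 mxE. Qed.

Lemma vanish_sum d (I : finType) (F : I -> A) :
  (forall i, vanish d (F i)) -> vanish d (\sum_i F i).
Proof.
move=> F0; apply: (big_ind (vanish d)) => // [|b c]; first exact: vanish0.
exact: vanishD.
Qed.

Lemma vanish_elt d l :
  vanish d (elt l) <-> forall j, (j < 14)%N -> (j < d)%N -> l`_j = 0.
Proof.
rewrite /vanish of_coordK; split=> [l0 j j14 jd | l0 j jd]; last by rewrite mxE l0.
by have := l0 (Ordinal j14) jd; rewrite mxE.
Qed.

(* As [nth] defaults to 0, [variables`_i] is 0 for [i >= 6]. *)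
Definition variables : seq A := [:: t; u; v; x; y; z].

Lemma vanish1_var i b : vanish 1 (variables`_i * b).
Proof.
case: (eltP b) => *; do 6?[case: i => [|i]] => /=;
  rewrite ?(mul_t, mul_u, mul_v, mul_x, mul_y, mul_z); try by apply/vanish_elt => -[].
by rewrite nth_nil mul0r; apply: vanish0.
Qed.

(** Positions 1 to 6 of [basis] have degree one, so once the constant term is zero, a product with a
    variable only involves positions from 7 on. *)
Lemma vanish7_var i b : vanish 1 b -> vanish 7 (variables`_i * b).
Proof.
case: (eltP b) => c0 ct cu cv cx cy cz ctv ctx cuv cvx cvy cvz cs /vanish_elt b0.
have /= -> := b0 0%N isT isT.
do 6?[case: i => [|i]] => /=; rewrite ?(mul_t, mul_u, mul_v, mul_x, mul_y, mul_z);
  try by apply/vanish_elt; do 7?[case=> //].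
by rewrite nth_nil mul0r; apply: vanish0.
Qed.

Lemma vanish_maxid b : b \in maxid alpha -> vanish 1 b.
Proof.
by move=> /asboolP[c ->]; apply: vanish_sum => i; rewrite mulrC; apply: vanish1_var.
Qed.

Lemma maxid_vanish b : vanish 1 b -> b \in maxid alpha.
Proof.
case: (eltP b) => c0 ct cu cv cx cy cz ctv ctx cuv cvx cvy cvz cs /vanish_elt b0.
have /= -> := b0 0%N isT isT.
apply/asboolP.
(* Each basis monomial other than 1 is assigned to one variable dividing it. *)
exists (fun i => [:: cst ct + cst ctv * v + cst ctx * x + cst cs * (v * x);
  cst cu + cst cuv * v; cst cv + cst cvx * x + cst cvy * y + cst cvz * z;
  cst cx; cst cy; cst cz]`_i).
by rewrite eltE !big_ord_recr big_ord0 /=; ring.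
Qed.

Lemma vanishM b c : vanish 1 b -> vanish 1 (c * b).
Proof.
move=> /maxid_vanish/asboolP[e ->]; rewrite mulr_sumr; apply: vanish_sum => i.
by rewrite mulrA mulrC; apply: vanish1_var.
Qed.

Lemma vanish2 b c : vanish 1 b -> vanish 1 c -> vanish 7 (b * c).
Proof.
move=> /maxid_vanish/asboolP[e ->] c0; rewrite mulr_suml; apply: vanish_sum => i.
by rewrite mulrAC mulrC; apply/vanish7_var/vanishM.
Qed.

Lemma dimv_zero_cols m p q (U : {vspace 'M[k]_(m, p + q)}) :
  (forall X, X \in U -> forall i (j : 'I_(p + q)), (j < p)%N -> X i j = 0) ->
  (\dim U <= m * q)%N.
Proof.
move=> U0; apply: dimv_lsubmx_eq0 => X /U0 X0.
by apply/matrixP => i j; rewrite !mxE X0 //= ltn_ord.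
Qed.

Lemma mxdim_le13 m n (D : 'M[A]_(m, n)) :
  (forall i j, vanish 1 (D i j)) -> (mxdim D <= m * 13)%N.
Proof.
move=> D1; apply: (@dimv_zero_cols m 1 13) => _ /memv_imgP[X _ ->] i j j1.
rewrite lfunE /= mxE; apply: (_ : vanish 1 _) => //.
by rewrite mxE; apply: vanish_sum => l; rewrite mulrC; apply: vanishM.
Qed.

(** Columns from [h] on lie in the square of the maximal ideal. If the first [h] entries of the
    argument also have zero constant term, the value lies in that square in each of the [m] rows,
    where 7 coordinates remain; this condition has codimension at most [h]. *)
Lemma mxdim_le7 m n h (D : 'M[A]_(m, n)) : (h <= n)%N ->
  (forall i j, vanish 1 (D i j)) ->
  (forall i (j : 'I_n) (b : A), (h <= j)%N -> vanish 7 (D i j * b)) ->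
  (mxdim D <= h + m * 7)%N.
Proof.
move=> hn D1 D2.
pose g (X : 'M[k]_(n, 14)) : 'cV[k]_h := \col_j X (widen_ord hn j) 0.
have g_linear : linear g by move=> c X Y; apply/colP => j; rewrite !mxE.
pose gL : {linear 'M[k]_(n, 14) -> 'cV[k]_h} :=
  HB.pack g (GRing.isLinear.Build _ _ _ _ g g_linear).
apply: leq_trans (limg_dim_lker _ (linfun gL)) _.
have -> : dim 'cV[k]_h = h by apply: muln1.
rewrite addnC leq_add2l; apply: (@dimv_zero_cols m 7 7) => _ /memv_imgP[X Xg ->] i j j7.
move: Xg; rewrite memv_ker lfunE /= => /eqP/colP X0.
rewrite lfunE /= mxE; apply: (_ : vanish 7 _) => //.
rewrite mxE; apply: vanish_sum => l; case: (leqP h l) => [hl | lh]; first exact: D2.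
apply: vanish2; first exact: D1.
move=> o; case: o => -[] // o14 _; rewrite [X in coord X]mxE of_coordK mxE.
have := X0 (Ordinal lh); rewrite !mxE => <-; congr (X _ _); exact: val_inj.
Qed.

Lemma minimal_vanish m n (D : 'M[A]_(m, n)) :
  minimal_map (maxid alpha) (mulmx D : {linear 'cV_n -> 'cV_m}) ->
  forall i j, vanish 1 (D i j).
Proof.
move=> Dmin i j; have [p [b [w [bm]]]] := Dmin (delta_mx j 0).
move=> /matrixP/(_ i 0); rewrite /= -colE mxE summxE => ->.
by apply: vanish_sum => l; rewrite mxE mulrC; apply/vanishM/vanish_maxid.
Qed.

(** In the exactness identity for [mxdim], bounding the later term by 13 times its rank bounds the
    earlier one below, giving the first inequality; bounding both terms by [le7] gives the
    second. *)
Lemma minimal_resolution_ranks (r : nat -> nat) (f : forall n, 'M[A]_(r n, r n.+1)) n :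
  minimal_free_resolution_of_coker (maxid alpha) f ->
  (r n.+1 <= 13 * r n)%N && (6 * r n.+1 <= r n.+2 + 7 * r n)%N.
Proof.
move=> [fex fmin]; have f1 m := minimal_vanish (fmin m).
have := mxdim_exact (fex n).
have := mxdim_le13 (f1 n); have := mxdim_le13 (f1 n.+1).
have le7 m : (mxdim (f m) <= r m.+1 + r m * 7)%N.
  by apply: mxdim_le7 => // i j b; rewrite leqNgt ltn_ord.
have := le7 n; have := le7 n.+1; lia.
Qed.

(** The third column has entries 0 and [tv], both in the square of the maximal ideal, so [h = 2] and
    the bound is 2 + 2 * 7. *)
Lemma mxdim_d_one : (forall i j, vanish 1 (d_one alpha i j)) ->
  (mxdim (d_one alpha) <= 16)%N.
Proof.
move=> d1; apply: (mxdim_le7 (h := 2)) => // i j b.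
case: j => -[|[|[|//]]] // j3 _; rewrite mxE /=; case: i => -[|[|//]] i2 /=.
  by rewrite mul0r; apply: vanish0.
rewrite rmorphM -mulrA; apply: (vanish7_var 0).
exact: (vanish1_var 2).
Qed.

(** * Exactness of the dual, and minimality in non-positive degrees *)

(** A functional that vanishes on the image of [E] is a row vanishing on the kernel of [D], hence a
    multiple of [D] by [self_injective]. *)
Lemma self_dual_exact m n p (D : 'M[A]_(m, n)) (E : 'M[A]_(n, p)) :
  exact_pair (mulmx E : {linear 'cV_p -> 'cV_n}) (mulmx D : {linear 'cV_n -> 'cV_m}) ->
  forall phi : {linear 'cV[A]_n -> A^o},
  (forall w, phi (E *m w) = 0) <->
  exists psi : {linear 'cV[A]_m -> A^o}, forall w, psi (D *m w) = phi w.
Proof.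
move=> DE phi; split=> [phi0 | [psi psiD] w]; last first.
  have /= D0 := (DE (E *m w)).2 (ex_intro _ w erefl).
  by rewrite -psiD D0 linear0.
pose p' : 'rV[A]_n := \row_j phi (delta_mx j 0).
have phiE w : phi w = (p' *m w) 0 0.
  rewrite [w in LHS]matrix_sum_delta mxE linear_sum; apply: eq_bigr => j _ /=.
  by rewrite big_ord1 linearZ !mxE mulrC.
have [w Dw0|q pE] := self_injective (D := D) (p := p').
  have [w' <-] := (DE w).1 Dw0.
  by apply/matrixP => i j; rewrite !ord1 -phiE phi0 mxE.
pose g (w : 'cV[A]_m) : A^o := (q *m w) 0 0.
have g_linear : linear g by move=> c w w'; rewrite /g mulmxDr -scalemxAr !mxE.
exists (HB.pack g (GRing.isLinear.Build _ _ _ _ g g_linear) : {linear 'cV[A]_m -> A^o}).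
by move=> w; rewrite phiE pE -mulmxA.
Qed.

Lemma minimal_d_nonpos i :
  minimal_map (maxid alpha) (mulmx (d_nonpos alpha i) : {linear 'cV_2 -> 'cV_2}).
Proof.
move=> w /=; exists 2%N, (fun j => (d_nonpos alpha i *m w) j 0).
exists (fun j => delta_mx j 0); split=> [j|]; last first.
  by rewrite [LHS]matrix_sum_delta; apply: eq_bigr => j _; rewrite big_ord1.
apply: maxid_vanish; case: j => -[|[|//]] j2.
  rewrite (_ : Ordinal j2 = 0); last exact: val_inj.
  by rewrite d_nonposE; apply: vanishD;
     [apply: (vanish1_var 2) | apply: (vanish1_var 4)].
rewrite (_ : Ordinal j2 = 1); last exact: val_inj.
by rewrite d_nonposE -mulrA mulrCA; apply: vanishD;
   [apply: (vanish1_var 3) | apply: (vanish1_var 5)].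
Qed.

End Ring.

(** * Exponential growth from ratio bounds, and the complete resolution *)

Lemma exponential_growth_of_ratio (RR : realType) (c : nat -> nat) :
  c 1%N = 3%N -> (forall n, c n.+1 <= 13 * c n)%N ->
  (forall n, 5 * c n.+1 <= 3 * c n.+2)%N -> exponential_growth RR c.
Proof.
move=> c1 cle cge; exists (5%:R / 3%:R), 26%:R; split.
- by rewrite ltr_pdivlMr ?ltr0n // mul1r ltr_nat.
- by rewrite ler_pdivrMr ?ltr0n // -natrM ler_nat.
exists 1%N => -[//|n] _; split.
  (* Denominators are cleared so that the induction takes place in the natural numbers. *)
  suff : (5 ^ n.+1 <= c n.+1 * 3 ^ n.+1)%N.
    by rewrite -(ler_nat RR) natrM !natrX expr_div_n ler_pdivrMr // exprn_gt0 ?ltr0n.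
  elim: n => [|n IH]; first by rewrite c1.
  by rewrite expnS [in X in (_ <= X)%N]expnS; have := cge n; nia.
rewrite -natrX ler_nat; elim: n => [|n IH]; first by rewrite c1.
by apply: leq_trans (cle _) _; rewrite [in X in (_ <= X)%N]expnS; lia.
Qed.

Theorem theorem2p4 (RR : realType) (k : fieldType) (alpha : k)
    (hk : ~ algebraic_over_finite_field k)
    (halpha : infinite_mult_order alpha)
    (beta : nat -> nat)
    (d : forall n : nat,
      'M[ringR alpha]_(res_rank beta n.+1, res_rank beta n.+2))
    (hd : minimal_free_resolution_of_coker (maxid alpha) (res_diff d)) :
  complete_resolution (C_diff d) /\
  minimal_complex (maxid alpha) (C_diff d) /\
  (exists c : nat -> nat,
     (forall n : nat, free_of_rank (C_mod alpha beta n%:Z) (c n)) /\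
     exponential_growth RR c) /\
  (forall i : int, i <= 0 -> free_of_rank (C_mod alpha beta i) 2).
Proof.
have free_cV n : free_of_rank ('cV[ringR alpha]_n : lmodType _) n.
  by exists (@idfun 'cV[ringR alpha]_n : {linear _ -> _}); exists id.
have C_exact : exact_complex (C_diff d).
  (* The cases are [i = 0], [i = 1], [i = 2], [i >= 3] and [i < 0], each asserting exactness in
     degree [i - 1]; the resolution hypothesis takes over from [i = 2]. *)
  case=> [[|[|[|n]]]|n].
  - exact: (exact_d_nonpos (i := 0) halpha isT).
  - exact: (exact_d_one halpha).
  - exact: hd.1 0%N.
  - exact: hd.1 n.+1.
  - exact: (exact_d_nonpos (i := Negz n) halpha isT).
split; [split | split; [|split]].
- by move=> i; exists (C_rank beta i); apply: free_cV.
- exact: C_exact.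
- by move=> i; apply: self_dual_exact (C_exact i).
- case=> [[|[|n]]|n].
  + exact: minimal_d_nonpos.
  + exact: hd.2 0%N.
  + exact: hd.2 n.+1.
  + exact: minimal_d_nonpos.
- exists (res_rank beta); split; first by move=> n; apply: free_cV.
  have bounds n := andP (minimal_resolution_ranks n hd).
  apply: exponential_growth_of_ratio => // n; first by have [] := bounds n.
  (* A ratio of at least 5/3 makes the next ratio at least 6 - 7 * 3/5 = 9/5, which exceeds 5/3. *)
  elim: n => [|n IH]; last by have [_] := bounds n.+1; lia.
  (* In the base case the two image dimensions add up to 3 * 14 = 42, while they are at most 16 and
     [beta 2 + 21]; hence [beta 2 >= 5]. *)
  have := mxdim_d_one (minimal_vanish (hd.2 0%N)).
  have := mxdim_exact (hd.1 0%N).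
  have : (mxdim (res_diff d 1) <= res_rank beta 2 + 3 * 7)%N.
    apply: mxdim_le7 => // [|i j b]; last by rewrite leqNgt ltn_ord.
    exact: minimal_vanish (hd.2 1%N).
  by rewrite /=; lia.
by case=> [[|n]|n] //= _; apply: free_cV.
Qed.
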